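(* The only solutions of the system of equations \[ a^2+b=c^z, \qquad a+b^2=c^Z \] in positive integers $a,b,c,z,Z$ with $\min\{a,b,c\}>1$ and $\gcd(a,b)=1$ are $(a,b,c,z,Z)=(2,5,3,2,3)$ and $(a,b,c,z,Z)=(5,2,3,3,2)$. *)

(* Defs.v *)
From mathcomp Require Export all_boot.

(* Main.v *)
(** By symmetry let [b < a], so [Z < z], and put [N = c ^ Z], [M = c ^ (z - Z)].
    Since [a = - b ^ 2] mod [N] and [b] is prime to [c], [N] divides [b ^ 3 + 1],
    say [b ^ 3 + 1 = k N]; here [k < b], and we write [b = k + t].  Eliminating [a],
    [N = M + b (b + t)] and [k (M - t ^ 2) = t ^ 3 + 1].  Hence [M] divides [N],
    so [b + t = d M] and [1 + b d] is a power of [c]. Being powers of the same [c],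
    [M] and [1 + b d] are comparable for divisibility, and together with the size
    of [M = t ^ 2 + s], [k s = t ^ 3 + 1], this forces [t = d = 1] and [s = 2]. *)
Require Import Defs.
From mathcomp Require Import all_boot.
From mathcomp Require Import zify.

Lemma dvdn_exp_total (c m n : nat) : (c ^ m %| c ^ n) || (c ^ n %| c ^ m).
Proof.
by case: (leqP m n) => [|/ltnW] /(dvdn_exp2l c) ->; rewrite ?orbT.
Qed.

(** Here [t ^ 2 + s] is [M] and [P] is [c ^ n]. The equations are [k + 2 * t = d * M] times [s],
    with [k * s = t ^ 3 + 1], and [P = 1 + b * d] with [b = d * M - t]. Size decides which of [P]
    and [M] is the divisor, and it must then divide a small positive number. *)
Lemma residual_system (t s d P : nat) :
  0 < t -> 0 < s -> 0 < d ->
  s * d * (t ^ 2 + s) = t ^ 3 + 1 + 2 * t * s ->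
  P + d * t = 1 + d ^ 2 * (t ^ 2 + s) ->
  (P %| t ^ 2 + s) || (t ^ 2 + s %| P) ->
  [/\ t = 1, s = 2 & d = 1].
Proof.
move=> t0 s0 d0 eqd eqPd dvdP.
set M := t ^ 2 + s in eqd eqPd dvdP.
have le_tt : t <= t ^ 2 by rewrite -mulnn leq_pmull.
(* If [s * d < t], the left side of [eqd] is at most [t * M = t ^ 3 + t * s], too small. *)
have [j eqj] : exists j, s * d = t + j.
  exists (s * d - t); rewrite subnKC // leqNgt; apply/negP => /ltnW lt_sd_t.
  by have := leq_mul lt_sd_t (leqnn M); rewrite eqd /M; lia.
have eqts : j * M = t * s + 1.
  by move: eqd; rewrite eqj mulnDl /M; lia.
have j0 : 0 < j by case: j eqts {eqj} => //; lia.
have le_2t : 1 < t -> 2 * t <= t ^ 2.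
  by move=> t_gt1; rewrite -mulnn leq_mul2r t_gt1 orbT.
have le_dM : d * t <= d * M by rewrite leq_mul2l /M; lia.
have [d1 | d_gt1] : d = 1 \/ 1 < d by lia.
  subst d; have [t1 | t_gt1] : t = 1 \/ 1 < t by lia.
    subst t; have j1 : j = 1 by move: eqts; rewrite /M; clear; nia.
    by split => //; lia.
  (* Now [P = M - (t - 1)], so [P] would divide [t - 1], which is positive and below [P]. *)
  have ltP : P < M by lia.
  have P0 : 0 < P by lia.
  case/orP: dvdP => [dvdP | /(dvdn_leq P0)]; last by lia.
  have : P %| t - 1.
    rewrite -(@dvdn_addr P); last exact: dvdnn.
    by have -> : P + (t - 1) = M by lia.
  have t1_gt0 : 0 < t - 1 by lia.
  by move/(dvdn_leq t1_gt0); have := le_2t t_gt1; lia.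
have le_2M : 2 * M <= d * M by rewrite leq_mul2r d_gt1 orbT.
have le_2dM : 2 * (d * M) <= d ^ 2 * M.
  by rewrite -mulnn -[d * d * M]mulnA leq_mul2r d_gt1 orbT.
have ltP : M < P by lia.
have M0 : 0 < M by lia.
case/orP: dvdP => [/(dvdn_leq M0) | dvdP]; first by lia.
have lt_ddt : d <= d * t by rewrite leq_pmulr.
(* Reduce the equation for [P] modulo [M]; the resulting bound [t ^ 2 < M < d * t] gives [t < d]. *)
have dvddt : M %| d * t - 1.
  rewrite -(dvdn_addr _ dvdP).
  have -> : P + (d * t - 1) = d ^ 2 * M by lia.
  exact: dvdn_mull.
have le_dt : M <= d * t - 1 by apply: dvdn_leq dvddt; lia.
have lt_td : t < d.
  rewrite ltnNge; apply/negP => le_dt'.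
  by have := leq_mul le_dt' (leqnn t); rewrite mulnn; lia.
(* Otherwise [2 * d <= s * d = t + j <= 2 * t], against [t < d]. *)
have s1 : j <= t -> s = 1.
  move=> le_jt; apply/eqP; rewrite eqn_leq s0 andbT leqNgt; apply/negP => s_gt1.
  by have := leq_mul s_gt1 (leqnn d); lia.
have [t1 | t_gt1] : t = 1 \/ 1 < t by lia.
  exfalso; subst t; have j1 : j = 1 by move: eqts; rewrite /M; clear; nia.
  by have := s1 ltac:(lia); lia.
have le_jt : j <= t.
  rewrite leqNgt; apply/negP => /ltnW le_tj.
  have := leq_mul le_tj (leqnn M); rewrite eqts /M.
  by have := leq_mul (leqnn t) le_tt; have := le_2t t_gt1; lia.
have := leq_mul j0 (leqnn M); rewrite eqts /M (s1 le_jt).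
by have := le_2t t_gt1; lia.
Qed.

Lemma solution_of_ltn (a b c z Z : nat) :
  1 < b -> b < a -> 1 < c -> coprime a b ->
  a ^ 2 + b = c ^ z -> a + b ^ 2 = c ^ Z ->
  (a, b, c, z, Z) = (5, 2, 3, 3, 2).
Proof.
move=> b_gt1 lt_ba c_gt1 cop_ab eqz eqZ.
have lt_Zz : Z < z by rewrite -(ltn_exp2l _ _ c_gt1) -eqz -eqZ; nia.
have cop_Nb : coprime (a + b ^ 2) b.
  by rewrite /coprime gcdnC addnC -mulnn gcdnMDl gcdnC.
have [m eqm] : exists m, z = Z + m by exists (z - Z); lia.
have m0 : 0 < m by lia.
set M := c ^ m.
have eqM : a ^ 2 + b = (a + b ^ 2) * M by rewrite eqz eqZ eqm expnD.
have /dvdnP [k eqk] : a + b ^ 2 %| b ^ 3 + 1.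
  (* By [eqM], [b * (b ^ 3 + 1) = N * (M + b ^ 2 - a)]; the term [N * a] avoids the subtraction. *)
  rewrite -(@Gauss_dvdr _ b) // -(@dvdn_addr ((a + b ^ 2) * a)) ?dvdn_mulr //.
  have -> : (a + b ^ 2) * a + b * (b ^ 3 + 1) = (a + b ^ 2) * (M + b ^ 2).
    by rewrite [RHS]mulnDr -eqM; lia.
  exact: dvdn_mulr.
(* Otherwise [k * N >= a * b + b ^ 3 > b ^ 3 + 1]. *)
have lt_kb : k < b by rewrite ltnNge; apply/negP => le_bk; nia.
have k0 : 0 < k by case: k eqk {lt_kb} => //; lia.
have [t eqb] : exists t, b = k + t by exists (b - k); lia.
have t0 : 0 < t by lia.
have eqMa : M + b ^ 2 = a + b * k.
  (* Times [N], both sides become [a ^ 2 + a * b ^ 2 + b ^ 4 + b]. *)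
  apply/eqP; rewrite -(eqn_pmul2l (m := a + b ^ 2)); last by lia.
  by apply/eqP; rewrite mulnDr -eqM; nia.
have eqN : a + b ^ 2 = M + b * (b + t) by nia.
have lt_mZ : m < Z by rewrite -(ltn_exp2l _ _ c_gt1) -eqZ -/M eqN -[ltnLHS]addn0 ltn_add2l muln_gt0; lia.
have [n eqn] : exists n, Z = m + n by exists (Z - m); lia.
have eqNM : a + b ^ 2 = M * c ^ n by rewrite eqZ eqn expnD.
have M0 : 0 < M by rewrite expn_gt0; lia.
have cop_Mb : coprime M b.
  by apply: coprime_dvdl cop_Nb; rewrite eqNM dvdn_mulr.
have /dvdnP [d eqd] : M %| b + t.
  by rewrite -(Gauss_dvdr _ cop_Mb) -(@dvdn_addr M) // -eqN eqNM dvdn_mulr.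
have d0 : 0 < d by case: d eqd => //; lia.
have eq_cn : c ^ n = 1 + b * d.
  apply/eqP; rewrite -(eqn_pmul2l M0) -eqNM eqN eqd; apply/eqP; nia.
(* Put [eqN] into [k * N = b ^ 3 + 1]: as [b ^ 2 - k * (b + t) = t ^ 2], this leaves
   [k * M = b * t ^ 2 + 1]. *)
have eqkM : k * M = k * t ^ 2 + t ^ 3 + 1 by nia.
have lt_t2M : t ^ 2 < M by rewrite -(ltn_pmul2l k0) eqkM; lia.
have [s eqs] : exists s, M = t ^ 2 + s by exists (M - t ^ 2); lia.
have eqks : k * s = t ^ 3 + 1 by nia.
have s0 : 0 < s by lia.
have [t1 s2 d1] : [/\ t = 1, s = 2 & d = 1].
  apply: (@residual_system t s d (c ^ n)) => //.
  - by rewrite -eqs -mulnA -eqd; nia.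
  - by have := congr1 (muln d) eqd; rewrite -eqs eq_cn; lia.
  - by rewrite -eqs; exact: dvdn_exp_total.
subst t s d.
have k1 : k = 1 by lia.
have b2 : b = 2 by lia.
have M3 : M = 3 by lia.
have a5 : a = 5 by nia.
have c3 : c = 3.
  have : c %| 3 by rewrite -M3 /M -(prednK m0) expnS dvdn_mulr.
  by rewrite dvdn_divisors // !inE => /orP [] /eqP; lia.
move: eqz eqZ; rewrite a5 b2 c3 => eqz eqZ.
have -> : z = 3 by apply/eqP; rewrite -(eqn_exp2l _ _ (_ : 1 < 3)) // -eqz.
by have -> : Z = 2 by apply/eqP; rewrite -(eqn_exp2l _ _ (_ : 1 < 3)) // -eqZ.
Qed.

Theorem theorem1 (a b c z Z : nat) :
  [/\ [/\ 0 < a, 0 < b, 0 < c, 0 < z & 0 < Z],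
      1 < minn a (minn b c),
      gcdn a b = 1,
      a ^ 2 + b = c ^ z
    & a + b ^ 2 = c ^ Z]
  <->
  (a, b, c, z, Z) = (2, 5, 3, 2, 3) \/ (a, b, c, z, Z) = (5, 2, 3, 3, 2).
Proof.
split=> [[_ min_gt1 gcd_ab eqz eqZ] | [] [-> -> -> -> ->] //].
move: min_gt1; rewrite !leq_min => /and3P [a_gt1 b_gt1 c_gt1].
case: (ltngtP a b) => [lt_ab | lt_ba | eq_ab].
- left; suff [-> -> -> -> ->] : (b, a, c, Z, z) = (5, 2, 3, 3, 2) by [].
  by apply: solution_of_ltn; rewrite // 1?addnC // /coprime gcdnC gcd_ab.
- by right; apply: solution_of_ltn; rewrite // /coprime gcd_ab.
- by move: gcd_ab; rewrite eq_ab gcdnn => b1; rewrite b1 in b_gt1.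
Qed.
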